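(* Let $b,c,d$ be positive integers with $b,c\geq 2$, and let $n=c^{c\tau(t-1)}-1$, where $$t=2^{2^{2c^2+1}c^2(2b+d-1)},\qquad \tau=2^{c^{3bct}-c^{3ct}}.$$ Let $G$ be a $K_{b,b}$-free graph and let $\mathcal{S}$ be a set of subsets of $V(G)$ such that $0<|S|<c$ for every $S\in\mathcal{S}$. Then either $\mathcal{S}$ admits a hitting set $X\subseteq V(G)$ such that $\alpha(G[X])\leq bcn$, or there are $d$ sets $S_1,\ldots,S_d$ in $\mathcal{S}$ that are pairwise anticomplete in $G$.
   Context: Graphs are finite and simple (no loops or parallel edges). $G[X]$ is the subgraph of $G$ induced by $X\subseteq V(G)$. A graph $G$ is $H$-free if it has no induced subgraph isomorphic to $H$; in particular, $K_{b,b}$-free means that $G$ has no induced subgraph isomorphic to the complete bipartite graph $K_{b,b}$. A stable set is a set of pairwise nonadjacent vertices, and $\alpha(G)$ is the cardinality of a largest stable set in $G$. A hitting set for $\mathcal{S}$ is a set $X\subseteq V(G)$ with $X\cap S\neq\varnothing$ for every $S\in\mathcal{S}$. Two sets $S,S'\subseteq V(G)$ are anticomplete in $G$ if $S\cap S'=\varnothing$ and there is no edge of $G$ with one end in $S$ and the other in $S'$. *)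

(* Defs.v *)
From mathcomp Require Import all_boot.

Set Implicit Arguments.
Unset Strict Implicit.
Unset Printing Implicit Defensive.

Record sgraph := SGraph {
  vertex :> finType;
  adj : rel vertex;
  adj_sym : symmetric adj;
  adj_irrefl : irreflexive adj
}.

Section InducedSubgraph.
Variables (G : sgraph) (X : {set G}).

Definition induced_adj : rel {x : G | x \in X} :=
  fun u v => adj (val u) (val v).

Lemma induced_adj_sym : symmetric induced_adj.
Proof. by move=> u v; rewrite /induced_adj adj_sym. Qed.

Lemma induced_adj_irrefl : irreflexive induced_adj.
Proof. by move=> u; rewrite /induced_adj adj_irrefl. Qed.

Definition induced : sgraph := SGraph induced_adj_sym induced_adj_irrefl.
End InducedSubgraph.

Section CompleteBipartite.
Variables m n : nat.

Definition biclique_adj : rel ('I_m + 'I_n)%type :=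
  fun u v => match u, v with
             | inl _, inr _ | inr _, inl _ => true
             | _, _ => false
             end.

Lemma biclique_adj_sym : symmetric biclique_adj.
Proof. by case=> i [] j. Qed.

Lemma biclique_adj_irrefl : irreflexive biclique_adj.
Proof. by case. Qed.

Definition biclique : sgraph := SGraph biclique_adj_sym biclique_adj_irrefl.
End CompleteBipartite.

Definition isomorphic (G H : sgraph) : Prop :=
  exists2 f : G -> H, bijective f & forall x y, adj (f x) (f y) = adj x y.

Definition free (H G : sgraph) : Prop :=
  ~ exists X : {set G}, isomorphic (induced X) H.

Definition stable (G : sgraph) (A : {set G}) : bool :=
  [forall x in A, forall y in A, ~~ adj x y].

Definition alpha (G : sgraph) : nat := \max_(A : {set G} | stable A) #|A|.

Definition hitting_set (G : sgraph) (F : {set {set G}}) (X : {set G}) : Prop :=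
  forall S, S \in F -> X :&: S != set0.

Definition anticomplete (G : sgraph) (A B : {set G}) : Prop :=
  [disjoint A & B] /\ (forall x y, x \in A -> y \in B -> ~~ adj x y).

(* All truncated subtractions below are exact when b, c, d are positive. *)
Definition t_const (b c d : nat) : nat :=
  2 ^ (2 ^ (2 * c ^ 2 + 1) * c ^ 2 * (2 * b + d - 1)).

Definition tau_const (b c d : nat) : nat :=
  let t := t_const b c d in 2 ^ (c ^ (3 * b * c * t) - c ^ (3 * c * t)).

Definition n_const (b c d : nat) : nat :=
  c ^ (c * tau_const b c d * (t_const b c d - 1)) - 1.

(* Main.v *)
Require Import Defs.
From mathcomp Require Import all_boot.
From mathcomp Require Import order ssralg ssrnum rat.
From mathcomp Require Import ring lra zify.

(** The proof compares fractional hitting sets with random stable sets.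

    Fix a bound N and look for weights w >= 0 on the vertices that give every
    member of F weight at least 1 and every stable set weight at most N.  If
    such weights exist, the vertices v with c * w v >= 1 form a hitting set,
    because members of F have at most c vertices, and every stable set among
    these vertices has at most c * N elements ([rounding_hitting_set]).

    Otherwise linear programming duality ([fractional_hitting_duality]) gives
    weights y on F, of total Y, and p on the stable sets, of total P with
    Y >= N * P, such that every vertex is covered by y at most as much as by p.
    Draw two members S, S' of F at random, proportionally to y.  The expected
    number of pairs (u, v) in S * S' that are equal or adjacent is governed by
    the marginal of y on the vertices, which is a thinning r of the marginal
    of p.  It is therefore an average, over pairs of stable sets A, A', of the
    r-weighted number of equal or adjacent pairs in A * A'.  As there is no
    induced K_{b,b}, two stable sets span a bipartite graph without a b by b
    biclique, and a weighted form of the Kovari-Sos-Turan theorem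
    ([weighted_kovari_sos_turan]) bounds this number by a small fraction of
    the product of their weights, plus a linear error term.  The linear term
    is negligible since N is large.  So two random members of F are
    anticomplete with probability more than 1 - 1 / (4 * d)
    ([touching_mass]), and choosing greedily produces d pairwise anticomplete
    members ([greedy_selection]).

    The value of N that this needs is exponential in b * d * c ^ 2
    ([anticomplete_or_hitting]), far below the bound of the theorem
    ([bound_le_n_const]). *)

Set Implicit Arguments.
Unset Strict Implicit.
Unset Printing Implicit Defensive.

Import Order.TTheory GRing.Theory Num.Theory.

(** * Linear duality over an ordered field *)

Section LinearDuality.
Local Open Scope ring_scope.
Variable R : realFieldType.

Lemma small_perturbation (I : eqType) (f g : I -> R) (s : seq I) :
  (forall i, i \in s -> 0 < f i) ->
  exists2 e : R, 0 < e & forall i, i \in s -> 0 < f i + e * g i.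
Proof.
move=> f_gt0.
suff [e e_gt0 He]: exists2 e : R, 0 < e & forall i, i \in s -> e * `|g i| < f i.
  exists e => // i /He; have := ler_norm (- g i); rewrite normrN; nra.
elim: s f_gt0 => [|i s IH] f_gt0; first by exists 1.
have [|e e_gt0 He] := IH; first by move=> k ks; apply: f_gt0; rewrite inE ks orbT.
have fi : 0 < f i by apply: f_gt0; rewrite mem_head.
have gi : 0 < 1 + `|g i| by have := normr_ge0 (g i); lra.
have d_gt0 : 0 < f i / (1 + `|g i|) by rewrite divr_gt0.
exists (Num.min e (f i / (1 + `|g i|))); first by rewrite lt_min e_gt0.
move=> k; rewrite inE => /predU1P[->|ks].
  apply: (@le_lt_trans _ _ (f i / (1 + `|g i|) * `|g i|)).
    by rewrite ler_wpM2r // ge_min lexx orbT.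
  by rewrite -[ltRHS](divfK (lt0r_neq0 gi)) ltr_pM2l // ltrDr.
apply: le_lt_trans (He k ks); rewrite ler_wpM2r //.
by rewrite ge_min lexx.
Qed.

(** Gordan's alternative, by induction on the number of rows.  Project the
    other rows along the new row a i0 onto the hyperplane where coordinate j
    vanishes, and solve there.  A solution x is moved into the
    hyperplane orthogonal to a i0, where it has the same products with the
    rows, and then tilted slightly so that its product with a i0 becomes
    positive.  A dependency of the projected rows says that a nonnegative
    combination of the old rows equals l * a i0.  If l <= 0 this is a
    dependency of all rows; if l > 0, then a i0 lies in the cone of the old
    rows and any solution for these rows is a solution for a i0 too. *)
Lemma gordan (I : eqType) (V : finType) (a : I -> V -> R) (s : seq I) :
  uniq s ->
  (exists x : V -> R, forall i, i \in s -> 0 < \sum_v a i v * x v) \/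
  (exists y : I -> R,
    [/\ forall i, 0 <= y i, exists2 i, i \in s & 0 < y i &
        forall v, \sum_(i <- s) y i * a i v = 0]).
Proof.
elim: s a => [|i0 s IH] a /=; first by left; exists (fun=> 0).
move=> /andP[i0s Us].
have ext y (l : R) v : \sum_(i <- i0 :: s) (if i == i0 then l else y i) * a i v =
    l * a i0 v + \sum_(i <- s) y i * a i v.
  rewrite big_cons eqxx; congr (_ + _); apply: eq_big_seq => i si.
  by case: eqP si => // ->; rewrite (negbTE i0s).
have [/forallP a0|/forallPn[j aj]] := boolP [forall v, a i0 v == 0].
  right; exists (fun i => if i == i0 then 1 else 0); split.
  - by move=> i; case: ifP.
  - by exists i0; rewrite ?mem_head ?eqxx.
  by move=> v; rewrite ext (eqP (a0 v)) mulr0 add0r big1 // => i _; rewrite mul0r.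
pose b i v := a i v - a i j / a i0 j * a i0 v.
have [[x Hx]|[y [y0 ypos yb]]] := IH b Us.
  pose g i := a i j / a i0 j.
  have [e e_gt0 He] := small_perturbation g Hx.
  pose t := (\sum_v a i0 v * x v) / a i0 j - e / a i0 j.
  pose x' v := x v - (v == j)%:R * t.
  have dotx' i : \sum_v a i v * x' v = \sum_v a i v * x v - a i j * t.
    rewrite /x'; under eq_bigr do rewrite mulrBr.
    rewrite sumrB; congr (_ - _); rewrite (bigD1 j) //= eqxx mul1r big1 ?addr0 //.
    by move=> v /negbTE->; rewrite mul0r mulr0.
  left; exists x' => i; rewrite inE dotx' => /predU1P[->|si].
    by rewrite /t -mulrBl mulrC divfK //; lra.
  suff -> : \sum_v a i v * x v - a i j * t = \sum_v b i v * x v + e * g i by exact: He.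
  rewrite /b; under [in RHS]eq_bigr do rewrite mulrBl -!mulrA.
  rewrite sumrB -!mulr_sumr /t /g; ring.
pose l := \sum_(i <- s) y i * (a i j / a i0 j).
have yl v : \sum_(i <- s) y i * a i v = l * a i0 v.
  have := yb v; rewrite /b; under eq_bigr do rewrite mulrBr mulrA.
  by rewrite sumrB -mulr_suml => /eqP; rewrite subr_eq0 => /eqP.
have [l_le0|l_gt0] := lerP l 0.
  right; exists (fun i => if i == i0 then - l else y i); split.
  - by move=> i; case: ifP => // _; rewrite oppr_ge0.
  - have [i si yi] := ypos; exists i; rewrite ?inE ?si ?orbT //.
    by case: eqP si => // ->; rewrite (negbTE i0s).
  by move=> v; rewrite ext yl; ring.
have [[x Hx]|[z [z0 [i si zi] zb]]] := IH a Us; last first.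
  right; exists (fun i => if i == i0 then 0 else z i); split.
  - by move=> k; case: ifP.
  - exists i; rewrite ?inE ?si ?orbT //.
    by case: eqP si => // ->; rewrite (negbTE i0s).
  by move=> v; rewrite ext zb; ring.
left; exists x => i; rewrite inE => /predU1P[->|]; last exact: Hx.
rewrite -(pmulr_rgt0 _ l_gt0) mulr_sumr.
under eq_bigr do rewrite mulrA -yl mulr_suml.
rewrite exchange_big /=.
have [k sk yk] := ypos.
rewrite (bigD1_seq k) //=; apply: ltr_wpDr.
  rewrite big_seq_cond; apply: sumr_ge0 => i' /andP[si' _].
  under eq_bigr do rewrite -mulrA.
  by rewrite -mulr_sumr mulr_ge0 // ltW // Hx.
under eq_bigr do rewrite -mulrA.
by rewrite -mulr_sumr mulr_gt0 // Hx.
Qed.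

(** Gordan's alternative after adding the unit vectors as rows: they force x
    to be positive, and their multipliers are the slack in the inequalities
    that y satisfies. *)
Lemma ville (I V : finType) (a : I -> V -> R) :
  (exists2 x : V -> R, forall v, 0 < x v & forall i, 0 < \sum_v a i v * x v) \/
  (exists y : I -> R,
    [/\ forall i, 0 <= y i, exists i, 0 < y i &
        forall v, \sum_i y i * a i v <= 0]).
Proof.
pose a' (k : I + V) v : R := match k with inl i => a i v | inr u => (u == v)%:R end.
have [[x Hx]|[y [y0 [k _ yk] yb]]] := gordan a' (index_enum_uniq (I + V)%type).
  left; exists x => [u|i].
    have := Hx (inr u) (mem_index_enum _); rewrite (bigD1 u) //= eqxx mul1r big1 ?addr0 //.
    by move=> v; rewrite eq_sym => /negbTE->; rewrite mul0r.
  exact: (Hx (inl i) (mem_index_enum _)).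
have yE v : \sum_i y (inl i) * a i v = - y (inr v).
  move: (yb v); rewrite big_sumType /= (bigD1 (v : V)) //= eqxx mulr1 [X in _ + (_ + X)]big1.
    by rewrite addr0 => /eqP; rewrite addr_eq0 => /eqP.
  by move=> u /negbTE->; rewrite mulr0.
right; exists (fun i => y (inl i)); split=> [i||v]; rewrite ?yE ?oppr_le0 //.
case: k yk => [i yi|u yu]; first by exists i.
have [/existsP[i yi]|/existsPn yi] := boolP [exists i, 0 < y (inl i)]; first by exists i.
move: (yE u); rewrite big1 => [|i _].
  by move/eqP; rewrite eq_sym oppr_eq0 => /eqP yu0; rewrite yu0 ltxx in yu.
have /eqP -> : y (inl i) == 0 by rewrite eq_le y0 leNgt yi.
by rewrite mul0r.
Qed.

(** Duality for the linear program that minimizes the largest weight of a set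
    A j over all fractional hitting sets of the S i.  The bound is compared
    in homogeneous form, so p is not normalized to a probability. *)
Lemma fractional_hitting_duality (T I J : finType) (S : I -> {set T})
    (A : J -> {set T}) (N : R) : 0 < N -> (forall i, S i != set0) ->
  (exists w : T -> R, [/\ forall v, 0 <= w v,
      forall i, 1 <= \sum_(v in S i) w v &
      forall j, \sum_(v in A j) w v <= N]) \/
  (exists (y : I -> R) (p : J -> R),
    [/\ [/\ forall i, 0 <= y i & forall j, 0 <= p j], 0 < \sum_j p j,
        N * \sum_j p j <= \sum_i y i &
        forall v, \sum_(i | v \in S i) y i <= \sum_(j | v \in A j) p j]).
Proof.
move=> N_gt0 S_neq0.
(* The column None is a common scale s: the rows say w(S i) > s and
   w(A j) < N * s, and w / s is the fractional hitting set. *)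
pose a (k : I + J) (c : option T) : R := match k, c with
  | inl i, Some v => (v \in S i)%:R
  | inl i, None => -1
  | inr j, Some v => - (v \in A j)%:R
  | inr j, None => N
  end.
have sum_opt (f : option T -> R) : \sum_c f c = f None + \sum_v f (Some v).
  rewrite (bigD1 None) //=; congr (_ + _).
  rewrite (reindex_omap Some id) /=; last by case.
  by apply: eq_bigl => v; rewrite eqxx.
have sum_in (X : {set T}) (f : T -> R) : \sum_v (v \in X)%:R * f v = \sum_(v in X) f v.
  rewrite [RHS]big_mkcond; apply: eq_bigr => v _.
  by case: (v \in X); rewrite ?mul1r ?mul0r.
have [[x x_gt0 Hx]|[z [z0 zpos Hz]]] := ville a.
  have s0 := x_gt0 None.
  left; exists (fun v => x (Some v) / x None); split.
  - by move=> v; rewrite divr_ge0 // ltW.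
  - move=> i; have := Hx (inl i); rewrite sum_opt /= sum_in -mulr_suml.
    by rewrite ler_pdivlMr // => H; apply/ltW; lra.
  move=> j; have := Hx (inr j); rewrite sum_opt /=.
  under eq_bigr do rewrite mulNr.
  by rewrite sumrN sum_in -mulr_suml ler_pdivrMr // => H; apply/ltW; lra.
right; exists (fun i => z (inl i)), (fun j => z (inr j)).
have hN : N * \sum_j z (inr j) <= \sum_i z (inl i).
  have := Hz None; rewrite big_sumType /= -!mulr_suml mulrC; lra.
have hv v : \sum_(i | v \in S i) z (inl i) <= \sum_(j | v \in A j) z (inr j).
  have := Hz (Some v); rewrite big_sumType /=.
  under [X in _ + X]eq_bigr do rewrite mulrN.
  rewrite sumrN subr_le0 => H.
  rewrite big_mkcond [leRHS]big_mkcond /=.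
  apply: le_trans (le_trans _ H) _; rewrite le_eqVlt; apply/orP; left; apply/eqP;
  apply: eq_bigr => k _; by case: (_ \in _); rewrite ?mulr1 ?mulr0.
(* If p vanished, the marginals of y would vanish, hence y itself, because the
   sets S i are nonempty. *)
split=> //; rewrite lt_neqAle sumr_ge0 // andbT eq_sym; apply/negP => /eqP p0.
have zr j : z (inr j) = 0.
  by move/eqP: p0; rewrite psumr_eq0 // => /allP/(_ j (mem_index_enum _))/eqP.
have zl i : z (inl i) = 0.
  have /set0Pn[v vi] := S_neq0 i; apply/eqP; rewrite eq_le z0 andbT.
  apply: le_trans (_ : \sum_(k | v \in S k) z (inl k) <= _).
    by rewrite (bigD1 i) //= lerDl sumr_ge0.
  by rewrite (le_trans (hv v)) // big1.
by case: zpos => -[i|j]; rewrite ?zl ?zr ltxx.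
Qed.
End LinearDuality.

(** * Weighted bipartite graphs without large bicliques *)

Lemma ler_sum_sub (R : numDomainType) (I : finType) (P Q : pred I) (f : I -> R) :
  (forall i, 0 <= f i)%R -> (forall i, P i -> Q i) ->
  (\sum_(i | P i) f i <= \sum_(i | Q i) f i)%R.
Proof.
move=> f_ge0 PQ; rewrite big_mkcond [leRHS]big_mkcond /=; apply: ler_sum => i _.
by case: (boolP (P i)) => [/PQ->//|_]; case: ifP.
Qed.

Lemma exists_subset_card (T : finType) (A : {set T}) (k : nat) :
  k <= #|A| -> exists2 B : {set T}, B \subset A & #|B| = k.
Proof.
move=> kA; exists [set x in take k (enum A)].
  by apply/subsetP=> x; rewrite inE => /mem_take; rewrite mem_enum.
rewrite cardsE; have /card_uniqP -> := take_uniq k (enum_uniq (mem A)).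
by rewrite size_takel // -cardE.
Qed.

Lemma pigeonhole_traces (T : finType) (f : T -> {set T}) (U H : {set T}) (b : nat) :
  (forall u, u \in U -> f u \subset H) -> b * 2 ^ #|H| < #|U| ->
  exists Z : {set T}, b <= #|[set u in U | f u == Z]|.
Proof.
move=> fH; rewrite ltnNge => /negP big_U; apply/existsP; apply: contraT => /existsPn small.
case: big_U; rewrite -sum1_card (partition_big f (mem (powerset H))) /=; last first.
  by move=> u /fH; rewrite powersetE.
rewrite -card_powerset mulnC -sum_nat_const; apply: leq_sum => Z _.
rewrite sum1dep_card ltnW // ltnNge.
by apply: contra (small Z) => /leq_trans-> //; apply/subset_leq_card/subsetP=> x; rewrite !inE.
Qed.

Section WeightedBipartite.
Local Open Scope ring_scope.
Variables (R : realFieldType) (T : finType) (e : rel T) (r : T -> R).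
Hypotheses (r_ge0 : forall v, 0 <= r v) (r_le1 : forall v, r v <= 1).
Variables (b m : nat) (eps : R).
Hypotheses (m_gt0 : (0 < m)%N) (b_gt0 : (0 < b)%N) (eps_m : eps * m%:R = 2 * b%:R).

Lemma sum_le_card (A : {set T}) : \sum_(v in A) r v <= #|A|%:R.
Proof. by rewrite -sumr_const; apply: ler_sum => v _. Qed.

(** Double counting: the m vertices of H each see at least an eps-fraction of A,
    so the vertices of A with at least b neighbours in H number more than
    b * 2 ^ m, and b of them have the same neighbourhood in H.  The choice
    eps * m = 2 * b makes the vertices with fewer than b neighbours account
    for at most half of the count. *)
Lemma biclique_of_heavy (A H : {set T}) :
  #|H| = m -> (m * 2 ^ m)%:R < \sum_(u in A) r u ->
  (forall v, v \in H -> eps * \sum_(u in A) r u <= \sum_(u in A | e u v) r u) ->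
  exists A0 B0 : {set T}, [/\ A0 \subset A, B0 \subset H, (b <= #|A0|)%N,
    (b <= #|B0|)%N & forall u v, u \in A0 -> v \in B0 -> e u v].
Proof.
move=> cH bigA heavy; set W := \sum_(u in A) r u in bigA heavy *.
pose f u := [set v in H | e u v].
pose U := [set u in A | (b <= #|f u|)%N].
have count : eps * W * m%:R <= \sum_(u in A) r u * #|f u|%:R.
  have -> : \sum_(u in A) r u * #|f u|%:R =
      \sum_(v in H) \sum_(u in A | e u v) r u.
    rewrite (exchange_big_dep (mem A)) /=; last by move=> v u _ /andP[].
    apply: eq_bigr => u uA; rewrite uA -sumr_const mulr_sumr.
    by apply: eq_big => [v|v _]; rewrite ?inE ?mulr1.
  by rewrite -cH mulr_natr -sumr_const; apply: ler_sum.
have bound : \sum_(u in A) r u * #|f u|%:R <= m%:R * #|U|%:R + b%:R * W.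
  rewrite (bigID (fun u => b <= #|f u|)%N) /=; apply: lerD.
    apply: le_trans (_ : \sum_(u in U) m%:R <= _); last by rewrite sumr_const mulr_natr.
    rewrite [leRHS](eq_bigl (fun u => (u \in A) && (b <= #|f u|)%N)); last by move=> u; rewrite inE.
    apply: ler_sum => u _; rewrite -[leRHS]mul1r ler_pM // ler_nat -cH.
    by apply/subset_leq_card/subsetP=> v; rewrite inE => /andP[].
  apply: le_trans (_ : \sum_(u in A | ~~ (b <= #|f u|)%N) b%:R * r u <= _).
    apply: ler_sum => u /andP[_]; rewrite -ltnNge => /ltnW fu.
    by rewrite mulrC ler_wpM2r // ler_nat.
  by rewrite -mulr_sumr ler_wpM2l // [leRHS](bigID (fun u => b <= #|f u|)%N) /= lerDr sumr_ge0.
have big_U : (b * 2 ^ m < #|U|)%N.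
  have : b%:R * W <= m%:R * #|U|%:R.
    by move: count; rewrite mulrAC eps_m; move: bound; lra.
  have : b%:R * (m * 2 ^ m)%:R < b%:R * W by rewrite ltr_pM2l // ltr0n.
  move=> /lt_le_trans H1 /H1; rewrite -!natrM ltr_nat mulnCA ltn_pmul2l //.
have [Z bZ] : exists Z : {set T}, (b <= #|[set u in U | f u == Z]|)%N.
  apply: (pigeonhole_traces (H := H)); last by rewrite cH.
  by move=> u _; apply/subsetP=> v; rewrite inE => /andP[].
have [u0] : exists u, u \in [set u in U | f u == Z].
  by apply/set0Pn; rewrite -card_gt0 (leq_trans b_gt0).
rewrite !inE => /andP[/andP[_ bfu] /eqP fuZ].
exists [set u in U | f u == Z], Z; split=> //.
- by apply/subsetP=> u; rewrite !inE => /andP[/andP[]].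
- by rewrite -fuZ; apply/subsetP=> v; rewrite inE => /andP[].
- by rewrite -fuZ.
by move=> u v; rewrite !inE => /andP[_ /eqP<-]; rewrite inE => /andP[].
Qed.

(** If A weighs at most m * 2 ^ m, the trivial bound suffices.  Otherwise
    fewer than m vertices of B are heavy, that is, see at least an
    eps-fraction of A, and the light ones contribute at most the quadratic
    term. *)
Lemma weighted_kovari_sos_turan (A B : {set T}) :
  (forall A0 B0 : {set T}, A0 \subset A -> B0 \subset B ->
     (b <= #|A0|)%N -> (b <= #|B0|)%N ->
     ~ forall u v, u \in A0 -> v \in B0 -> e u v) ->
  \sum_(u in A) \sum_(v in B | e u v) r u * r v <=
    eps * (\sum_(u in A) r u) * (\sum_(v in B) r v) +
    (m * 2 ^ m)%:R * (\sum_(u in A) r u + \sum_(v in B) r v).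
Proof.
move=> nobic; set W := \sum_(u in A) r u; set W' := \sum_(v in B) r v.
have W0 : 0 <= W by apply: sumr_ge0.
have W'0 : 0 <= W' by apply: sumr_ge0.
have eps0 : 0 < eps by rewrite -(pmulr_lgt0 _ (_ : 0 < m%:R)) ?eps_m ?mulr_gt0 ?ltr0n.
pose D v := \sum_(u in A | e u v) r u.
have DW v : D v <= W by rewrite /W (bigID (e^~ v)) /= lerDl sumr_ge0.
have -> : \sum_(u in A) \sum_(v in B | e u v) r u * r v = \sum_(v in B) r v * D v.
  rewrite (exchange_big_dep (mem B)) /=; last by move=> u v _ /andP[].
  apply: eq_bigr => v vB; rewrite vB mulr_sumr.
  by apply: eq_bigr => u _; rewrite mulrC.
have [W_le|W_gt] := lerP W (m * 2 ^ m)%:R.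
  apply: le_trans (_ : \sum_(v in B) r v * W <= _).
    by apply: ler_sum => v _; rewrite ler_wpM2l.
  rewrite -mulr_suml -/W'.
  have : 0 <= eps * W * W' by rewrite !mulr_ge0 // ltW.
  have : 0 <= (m * 2 ^ m)%:R * W by rewrite mulr_ge0.
  have : W' * W <= (m * 2 ^ m)%:R * W' by rewrite mulrC ler_wpM2r.
  by rewrite mulrDr; lra.
pose H := [set v in B | eps * W <= D v].
have H_small : (#|H| < m)%N.
  rewrite ltnNge; apply/negP => /exists_subset_card[H0 H0H cH0].
  have [|A0 [B0 [sA0 sB0 cA0 cB0]]] := biclique_of_heavy cH0 W_gt.
    by move=> v /(subsetP H0H); rewrite inE => /andP[].
  apply: nobic => //; apply: subset_trans sB0 (subset_trans H0H _).
  by apply/subsetP=> v; rewrite inE => /andP[].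
have heavy_part : \sum_(v in H) r v * D v <= (m * 2 ^ m)%:R * W.
  apply: le_trans (_ : \sum_(v in H) r v * W <= _).
    by apply: ler_sum => v _; rewrite ler_wpM2l.
  rewrite -mulr_suml ler_wpM2r // (le_trans (sum_le_card H)) // ler_nat.
  by rewrite (leq_trans (ltnW H_small)) // leq_pmulr // expn_gt0.
have light_part : \sum_(v in B | ~~ (eps * W <= D v)) r v * D v <= eps * W * W'.
  apply: le_trans (_ : \sum_(v in B | ~~ (eps * W <= D v)) r v * (eps * W) <= _).
    by apply: ler_sum => v /andP[_]; rewrite -ltNge => /ltW Dv; rewrite ler_wpM2l.
  rewrite -mulr_suml mulrC ler_wpM2l ?mulr_ge0 ?(ltW eps0) //.
  by rewrite /W' [leRHS](bigID (fun v => eps * W <= D v)) /= lerDr sumr_ge0.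
rewrite (bigID (fun v => eps * W <= D v)) /= addrC.
rewrite mulrDr addrA -[leLHS]addr0; apply: lerD; last by rewrite mulr_ge0.
apply: lerD => //; apply: le_trans heavy_part; rewrite le_eqVlt; apply/orP; left.
by apply/eqP/eq_bigl => v; rewrite inE.
Qed.
End WeightedBipartite.

(** * Greedy selection of pairwise compatible indices *)

Section Greedy.
Local Open Scope ring_scope.
Variables (R : realFieldType) (I : finType) (conf : rel I) (y : I -> R).
Hypothesis y_ge0 : forall i, 0 <= y i.
Variables (delta Z : R).
Hypothesis delta_ge0 : 0 <= delta.

(** As long as the remaining weight is at least Z, some index conflicts with
    weight at most delta, by averaging.  Choosing it and discarding the
    indices that it conflicts with costs at most delta. *)
Lemma greedy_selection (k : nat) (P : {set I}) :
  \sum_(i in P) \sum_(j in P | conf i j) y i * y j < delta * Z ->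
  Z + k%:R * delta <= \sum_(i in P) y i ->
  exists s : seq I, [/\ size s = k, {subset s <= P} &
                        pairwise (fun i j => ~~ conf i j) s].
Proof.
elim: k P => [|k IH] P few_conf heavyP; first by exists [::].
pose D i := \sum_(j in P | conf i j) y j.
have [/exists_inP[i iP Di]|/exists_inPn Dbig] := boolP [exists i in P, D i <= delta]; last first.
  case/negP: (negbT (ltxx (delta * Z))); apply: le_lt_trans few_conf.
  apply: le_trans (_ : \sum_(i in P) y i * delta <= _).
    by rewrite -mulr_suml mulrC ler_wpM2r // (le_trans _ heavyP) // lerDl mulr_ge0.
  apply: ler_sum => i iP; rewrite -mulr_sumr ler_wpM2l //.
  by rewrite leNgt; apply/negP => /ltW; apply/negP/Dbig.
pose Q := [set j in P | ~~ conf i j].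
have QP j : j \in Q -> j \in P by rewrite inE => /andP[].
have [|| s [cs sQ sconf]] := IH Q.
- apply: le_lt_trans few_conf.
  apply: le_trans (_ : \sum_(j in Q) \sum_(l in P | conf j l) y j * y l <= _).
    apply: ler_sum => j _; apply: ler_sum_sub => [l|l /andP[/QP-> ->]//].
    exact: mulr_ge0.
  by apply: ler_sum_sub => // j; apply: sumr_ge0 => l _; apply: mulr_ge0.
- have : \sum_(j in P) y j = D i + \sum_(j in Q) y j.
    rewrite (bigID (conf i)) /=; congr (_ + _).
    by apply: eq_bigl => j; rewrite inE.
  move: heavyP; rewrite -natr1; move: Di; lra.
exists (i :: s); split=> /=; first by rewrite cs.
  by move=> j; rewrite inE => /predU1P[->//|/sQ/QP].
by rewrite sconf andbT; apply/allP=> j /sQ; rewrite inE => /andP[].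
Qed.
End Greedy.

(** * Stable sets and bicliques in graphs *)

Lemma stableP (G : sgraph) (A : {set G}) :
  reflect (forall x y, x \in A -> y \in A -> ~~ adj x y) (stable A).
Proof.
apply: (iffP forall_inP) => [H x y xA yA|H x xA]; first exact: (forall_inP (H x xA)).
by apply/forall_inP => y yA; apply: H.
Qed.

(** The parts A and B are disjoint because adjacency is irreflexive, so the
    position in the enumeration of its part identifies a vertex of A :|: B. *)
Lemma biclique_induced (b : nat) (G : sgraph) (A B : {set G}) :
  0 < b -> #|A| = b -> #|B| = b -> stable A -> stable B ->
  (forall u v, u \in A -> v \in B -> adj u v) ->
  isomorphic (induced (A :|: B)) (biclique b b).
Proof.
move=> b_gt0 cA cB /stableP sA /stableP sB AB.
have dAB x : x \in A -> x \in B -> False by move=> /AB H /H; rewrite adj_irrefl.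
case: b b_gt0 cA cB => // b _ cA cB.
pose f (z : induced (A :|: B)) : biclique b.+1 b.+1 :=
  if val z \in A then inl (inord (index (val z) (enum A)))
  else inr (inord (index (val z) (enum B))).
have idx (X : {set G}) (x y : G) : #|X| = b.+1 -> x \in X -> y \in X ->
    inord (index x (enum X)) = inord (index y (enum X)) :> 'I_b.+1 -> x = y.
  move=> cX xX yX /(congr1 val); rewrite /= !inordK -?cX; last 2 first.
  - by rewrite cardE index_mem mem_enum.
  - by rewrite cardE index_mem mem_enum.
  by move/(congr1 (nth x (enum X))); rewrite !nth_index ?mem_enum.
have inB (z : induced (A :|: B)) : val z \notin A -> val z \in B.
  by move=> /negbTE zA; have := valP z; rewrite inE zA.
have f_inj : injective f.
  move=> z w; rewrite /f; case: ifPn => zA; case: ifPn => wA // [] E; apply: val_inj.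
    exact: idx E.
  by apply: idx E; rewrite ?inB.
exists f; last first.
  move=> z w; rewrite /f [RHS]/(adj (val z) (val w)).
  case: ifPn => zA; case: ifPn => wA /=.
  - by apply/esym/negbTE/sA.
  - by apply/esym/AB => //; apply: inB.
  - by have := AB _ _ wA (inB _ zA); rewrite adj_sym => zw; apply: esym zw.
  by apply/esym/negbTE/sB; apply: inB.
apply: inj_card_bij f_inj _.
rewrite card_sum !card_ord card_sig.
have -> : #|[pred x | x \in A :|: B]| = #|A :|: B| by apply: eq_card => x; rewrite inE.
rewrite cardsU cA cB; have -> : A :&: B = set0; last by rewrite cards0 subn0.
by apply/setP => x; rewrite !inE; apply/negP => /andP[/dAB].
Qed.

Lemma no_biclique_between_stable (b : nat) (G : sgraph) (A B A0 B0 : {set G}) :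
  0 < b -> free (biclique b b) G -> stable A -> stable B -> A0 \subset A -> B0 \subset B ->
  b <= #|A0| -> b <= #|B0| -> ~ forall u v, u \in A0 -> v \in B0 -> adj u v.
Proof.
move=> b_gt0 hG /stableP sA /stableP sB A0A B0B /exists_subset_card[A1 A1A cA1].
move=> /exists_subset_card[B1 B1B cB1] AB; apply: hG; exists (A1 :|: B1).
apply: biclique_induced => //.
- by apply/stableP => x y xA yA; apply: sA; apply/(subsetP A0A)/(subsetP A1A).
- by apply/stableP => x y xA yA; apply: sB; apply/(subsetP B0B)/(subsetP B1B).
by move=> u v uA vB; apply: AB; [apply: (subsetP A1A) | apply: (subsetP B1B)].
Qed.

Definition touching (G : sgraph) (X Y : {set G}) : bool :=
  [exists u in X, exists v in Y, (u == v) || adj u v].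

Lemma not_touching_anticomplete (G : sgraph) (X Y : {set G}) :
  ~~ touching X Y -> anticomplete X Y.
Proof.
move=> /exists_inPn XY; split=> [|x y xX yY].
  apply/pred0P => x /=; apply/negP => /andP[xX xY].
  by have /exists_inPn/(_ x xY) := XY x xX; rewrite eqxx.
by have /exists_inPn/(_ y yY) := XY x xX; rewrite negb_or => /andP[].
Qed.

Lemma anticomplete_sym (G : sgraph) (X Y : {set G}) : anticomplete X Y -> anticomplete Y X.
Proof.
by move=> [dXY XY]; split=> [|x y xY yX]; rewrite 1?disjoint_sym // adj_sym XY.
Qed.

(** * Conflicts between random members of a family *)

Section Marginals.
Local Open Scope ring_scope.
Variables (R : realFieldType) (T : finType).

Definition marginal (I : finType) (X : I -> {set T}) (y : I -> R) (v : T) : R :=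
  \sum_(i | v \in X i) y i.

Lemma sum_marginal (I : finType) (X : I -> {set T}) (y : I -> R) (h : T -> R) :
  \sum_v h v * marginal X y v = \sum_i y i * \sum_(v in X i) h v.
Proof.
under eq_bigr do rewrite /marginal mulr_sumr.
rewrite (exchange_big_dep predT) //=; apply: eq_bigr => i _.
by rewrite mulr_sumr; apply: eq_bigr => v _; rewrite mulrC.
Qed.

Lemma sum_marginal2 (I : finType) (X : I -> {set T}) (y : I -> R) (g : T -> T -> R) :
  \sum_u (\sum_v g u v * marginal X y v) * marginal X y u =
  \sum_i \sum_j y i * y j * \sum_(u in X i) \sum_(v in X j) g u v.
Proof.
rewrite sum_marginal; apply: eq_bigr => i _.
under eq_bigr do rewrite sum_marginal.
rewrite exchange_big mulr_sumr; apply: eq_bigr => j _.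
by rewrite -mulr_sumr mulrA.
Qed.
End Marginals.

Section ConflictMass.
Local Open Scope ring_scope.
Variables (R : realFieldType) (b m : nat) (eps : R) (G : sgraph).
Hypotheses (b_gt0 : (0 < b)%N) (m_gt0 : (0 < m)%N) (eps_m : eps * m%:R = 2 * b%:R).
Hypothesis hG : free (biclique b b) G.

Let K : R := (m * 2 ^ m)%:R + 1.
Let near (u v : G) : bool := (u == v) || adj u v.

(** Equal pairs contribute only a linear term, which accounts for the 1 in K;
    adjacent pairs form a bipartite graph without a b by b biclique. *)
Lemma near_mass_stable (r : G -> R) (A B : {set G}) :
  (forall v, 0 <= r v) -> (forall v, r v <= 1) -> stable A -> stable B ->
  \sum_(u in A) \sum_(v in B) (near u v)%:R * r u * r v <=
    eps * (\sum_(u in A) r u) * (\sum_(v in B) r v) +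
    K * (\sum_(u in A) r u + \sum_(v in B) r v).
Proof.
move=> r0 r1 sA sB.
have adj_part := weighted_kovari_sos_turan (e := @adj G) r0 r1 m_gt0 b_gt0 eps_m
  (fun A0 B0 A0A B0B => @no_biclique_between_stable b G A B A0 B0 b_gt0 hG sA sB A0A B0B).
have eq_part : \sum_(u in A) \sum_(v in B) (u == v)%:R * r u * r v <= \sum_(u in A) r u.
  apply: ler_sum => u _.
  apply: le_trans (_ : \sum_v (u == v)%:R * r u * r v <= _).
    by apply: ler_sum_sub => // v; rewrite !mulr_ge0.
  rewrite (bigD1 u) //= eqxx mul1r big1 ?addr0; last first.
    by move=> v; rewrite eq_sym => /negbTE->; rewrite !mul0r.
  by rewrite -[leRHS]mulr1 ler_wpM2l.
have B0 : 0 <= \sum_(v in B) r v by apply: sumr_ge0.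
have split_near : \sum_(u in A) \sum_(v in B) (near u v)%:R * r u * r v <=
    \sum_(u in A) \sum_(v in B) (u == v)%:R * r u * r v +
    \sum_(u in A) \sum_(v in B | adj u v) r u * r v.
  rewrite -big_split /=; apply: ler_sum => u _.
  rewrite [X in _ + X]big_mkcondr -big_split /=; apply: ler_sum => v _.
  rewrite /near; have : 0 <= r u * r v by rewrite mulr_ge0.
  by case: (u == v); case: (adj u v) => /=; rewrite ?mul1r ?mul0r ?addr0 ?add0r //; lra.
rewrite /K; move: adj_part eq_part split_near B0; lra.
Qed.

(** The transfer from the family S to the stable sets A.  Since the marginal q
    of y is at most the marginal of p, it is r times the latter with
    0 <= r <= 1.  The sum of q u * q v over equal or adjacent pairs bounds the
    touching mass from above, and expanding the marginals of p turns it into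
    a p-average of the bound for two stable sets with vertex weights r. *)
Lemma touching_mass (I J : finType) (S : I -> {set G}) (A : J -> {set G})
    (y : I -> R) (p : J -> R) (c : nat) :
  (forall i, 0 <= y i) -> (forall j, 0 <= p j) ->
  (forall i, #|S i| <= c)%N -> (forall j, stable (A j)) ->
  (forall v, marginal S y v <= marginal A p v) ->
  \sum_i \sum_(j | touching (S i) (S j)) y i * y j <=
    eps * (c%:R * \sum_i y i) ^+ 2 + 2 * K * (\sum_j p j) * (c%:R * \sum_i y i).
Proof.
move=> y0 p0 cS sA qp.
(* Where the marginal of p is 0, so is that of y, and division yields 0. *)
pose r v := marginal S y v / marginal A p v.
have q0 v : 0 <= marginal S y v by apply: sumr_ge0.
have pbar0 v : 0 <= marginal A p v by apply: sumr_ge0.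
have r0 v : 0 <= r v by rewrite divr_ge0.
have qE v : marginal S y v = r v * marginal A p v.
  have [pv|pv] := eqVneq (marginal A p v) 0; last by rewrite /r divfK.
  by apply/eqP; rewrite pv mulr0 eq_le q0 andbT -pv.
have r1 v : r v <= 1.
  have [pv|pv] := eqVneq (marginal A p v) 0; first by rewrite /r pv invr0 mulr0.
  by rewrite /r ler_pdivrMr ?mul1r // lt0r pv pbar0.
set Y := \sum_i y i; set P := \sum_j p j.
pose rho j := \sum_(v in A j) r v.
pose Q := \sum_j p j * rho j.
have QY : Q <= c%:R * Y.
  rewrite /Q -sum_marginal; under eq_bigr do rewrite -qE -[marginal _ _ _]mul1r.
  rewrite sum_marginal mulr_sumr; apply: ler_sum => i _.
  by rewrite sumr_const mulrC ler_wpM2r // ler_nat.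
have Q0 : 0 <= Q by apply: sumr_ge0 => j _; rewrite mulr_ge0 // sumr_ge0.
have eps0 : 0 <= eps.
  by rewrite -(pmulr_lge0 _ (_ : 0 < m%:R)) ?eps_m ?mulr_ge0 ?ltr0n.
have K0 : 0 <= K by rewrite /K addr_ge0.
have P0 : 0 <= P by apply: sumr_ge0.
apply: le_trans (_ : eps * Q ^+ 2 + 2 * K * P * Q <= _); last first.
  apply: lerD; last by rewrite ler_wpM2l // !mulr_ge0.
  by rewrite ler_wpM2l // lerXn2r // nnegrE // (le_trans Q0).
apply: le_trans (_ : \sum_i \sum_j y i * y j *
    \sum_(u in S i) \sum_(v in S j) (near u v)%:R <= _).
  apply: ler_sum => i _; rewrite big_mkcond /=; apply: ler_sum => j _.
  have near0 (V : {set G}) u : 0 <= \sum_(v in V) (near u v)%:R :> R by apply: sumr_ge0.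
  case: ifPn => [/exists_inP[u uS /exists_inP[v vS uv]]|_]; last first.
    by rewrite !mulr_ge0 // sumr_ge0 // => u _; apply: near0.
  rewrite -[leLHS]mulr1 ler_wpM2l ?mulr_ge0 //.
  rewrite (bigD1 u) //= (bigD1 v) //= /near uv -addrA lerDl addr_ge0 // sumr_ge0 // => w _.
  exact: near0.
rewrite -sum_marginal2.
have -> : \sum_u (\sum_v (near u v)%:R * marginal S y v) * marginal S y u =
  \sum_u (\sum_v ((near u v)%:R * r u * r v) * marginal A p v) * marginal A p u.
  apply: eq_bigr => u _; rewrite !mulr_suml; apply: eq_bigr => v _.
  by rewrite !qE; ring.
rewrite sum_marginal2.
apply: le_trans (_ : \sum_i \sum_j p i * p j *
    (eps * rho i * rho j + K * (rho i + rho j)) <= _).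
  apply: ler_sum => i _; apply: ler_sum => j _.
  by rewrite ler_wpM2l ?mulr_ge0 // near_mass_stable.
have -> : \sum_i \sum_j p i * p j * (eps * rho i * rho j + K * (rho i + rho j)) =
    \sum_i (p i * rho i * (eps * Q + K * P) + p i * (K * Q)).
  apply: eq_bigr => i _; transitivity
    ((p i * rho i * eps + p i * K) * Q + p i * rho i * K * P); last by ring.
  have -> z : z * Q = \sum_j z * (p j * rho j) by rewrite mulr_sumr.
  have -> z : z * P = \sum_j z * p j by rewrite mulr_sumr.
  rewrite -big_split /=.
  by apply: eq_bigr => j _; ring.
rewrite big_split /= -!mulr_suml -/Q -/P le_eqVlt; apply/orP; left; apply/eqP; ring.
Qed.
End ConflictMass.

(** * Hitting sets and anticomplete members *)

(** A member of F has at most c vertices and weight at least 1, so one of its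
    vertices has weight at least 1 / c. *)
Lemma rounding_hitting_set (R : realFieldType) (G : sgraph) (F : {set {set G}})
    (w : G -> R) (c N : nat) :
  (forall S, S \in F -> #|S| <= c) ->
  (forall v, 0 <= w v)%R ->
  (forall S, S \in F -> 1 <= \sum_(v in S) w v)%R ->
  (forall A : {set G}, stable A -> \sum_(v in A) w v <= N%:R)%R ->
  exists2 X : {set G}, hitting_set F X & alpha (induced X) <= c * N.
Proof.
move=> cF w0 wF wA; exists [set v | (1 <= c%:R * w v)%R].
  move=> S SF; apply/set0Pn.
  have [/existsP[v /andP[vS wv]]|/existsPn small] :=
      boolP [exists v, (v \in S) && (1 <= c%:R * w v)%R].
    by exists v; rewrite !inE wv.
  have [S0|/set0Pn[v vS]] := eqVneq S set0.
    by have := wF S SF; rewrite S0 big_set0 ler10.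
  have lt1 u : u \in S -> (c%:R * w u < 1)%R.
    by move=> uS; have := small u; rewrite uS /= -ltNge.
  have : (c%:R * \sum_(u in S) w u < c%:R)%R.
    apply: (@lt_le_trans _ _ (#|S|%:R)%R); last by rewrite ler_nat cF.
    rewrite mulr_sumr -sumr_const (bigD1 v) //= [ltRHS](bigD1 v) //=.
    rewrite ltr_leD ?lt1 //; apply: ler_sum => u /andP[uS _].
    exact/ltW/lt1.
  by rewrite ltNge; case/negP; rewrite ler_peMr // wF.
apply/bigmax_leqP => A /stableP sA.
have val_inj' : injective (val : induced [set v | (1 <= c%:R * w v)%R] -> G) := val_inj.
rewrite -(card_imset _ val_inj') -(ler_nat R) natrM.
have sA' : stable (val @: A).
  by apply/stableP => _ _ /imsetP[x xA ->] /imsetP[y yA ->]; apply: sA.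
apply: (@le_trans _ _ (c%:R * \sum_(v in val @: A) w v)%R); last first.
  by rewrite ler_wpM2l // wA.
rewrite -sumr_const mulr_sumr; apply: ler_sum => _ /imsetP[x _ ->].
by have := valP x; rewrite inE.
Qed.

(** With eps = 1 / (8 * d * c ^ 2) the quadratic term of the touching mass is
    at most Y ^ 2 / (8 * d), and m is the value for which eps * m = 2 * b.
    The factor 32 in N makes the linear term at most half as large.  Hence the
    touching mass is below Y ^ 2 / (4 * d), which lets the greedy choice make
    d steps, each costing at most Y / (2 * d), before the weight falls below Y / 2. *)
Theorem anticomplete_or_hitting (b c d m N : nat) (G : sgraph) (F : {set {set G}}) :
  0 < b -> 0 < c -> 0 < d -> free (biclique b b) G ->
  (forall S : {set G}, S \in F -> 0 < #|S| <= c) ->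
  m = 16 * b * d * c ^ 2 -> N = 32 * (m * 2 ^ m + 1) * c * d ->
  (exists2 X : {set G}, hitting_set F X & alpha (induced X) <= c * N) \/
  (exists S : 'I_d -> {set G}, (forall i, S i \in F) /\
     (forall i j, i != j -> anticomplete (S i) (S j))).
Proof.
move=> b_gt0 c_gt0 d_gt0 hG hF mE NE.
pose I := {S : {set G} | S \in F}; pose J := {A : {set G} | stable A}.
have N_gt0 : (0 < N%:R :> rat)%R by rewrite ltr0n NE !muln_gt0 addn1 c_gt0 d_gt0.
have S_neq0 (i : I) : val i != set0.
  by rewrite -card_gt0; case/andP: (hF _ (valP i)).
have [[w [w0 wF wA]]|[y [p [[y0 p0] P0 NPY qp]]]] :=
    fractional_hitting_duality (fun j : J => val j) N_gt0 S_neq0.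
  left; apply: (rounding_hitting_set (w := w)) => //.
  - by move=> S /hF /andP[].
  - by move=> S SF; apply: (wF (exist _ S SF)).
  by move=> A sA; apply: (wA (exist _ A sA)).
right.
set P := (\sum_j p j)%R in P0 NPY; set Y := (\sum_i y i)%R in NPY.
have Y_gt0 : (0 < Y)%R by apply: lt_le_trans NPY; rewrite mulr_gt0.
have dR : (0 < d%:R :> rat)%R by rewrite ltr0n.
have cR : (0 < c%:R :> rat)%R by rewrite ltr0n.
pose eps : rat := (8 * d%:R * c%:R ^+ 2)^-1%R.
have eps_m : (eps * m%:R = 2 * b%:R)%R.
  rewrite /eps mE !natrM; field.
  by rewrite !lt0r_neq0.
have m_gt0 : 0 < m by rewrite mE !muln_gt0 b_gt0 d_gt0 c_gt0.
have mass := @touching_mass _ b m eps G b_gt0 m_gt0 eps_m hG I J val val y p c y0 p0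
  (fun i => proj2 (andP (hF _ (valP i)))) (fun j => valP j) qp.
have few : (\sum_i \sum_(j | touching (val i) (val j)) y i * y j <
    Y / (2 * d%:R) * (Y / 2))%R.
  apply: le_lt_trans mass _; rewrite -/P -/Y.
  set K : rat := ((m * 2 ^ m)%:R + 1)%R.
  have NK : (N%:R = 32 * K * c%:R * d%:R :> rat)%R by rewrite NE !natrM natrD.
  have -> : (eps * (c%:R * Y) ^+ 2 = Y ^+ 2 / (8 * d%:R))%R.
    by rewrite /eps; field; rewrite !lt0r_neq0.
  have PY : (2 * K * P * (c%:R * Y) <= Y ^+ 2 / (16 * d%:R))%R.
    have -> : (2 * K * P * (c%:R * Y) = N%:R * P * (Y / (16 * d%:R)))%R.
      by rewrite NK; field; rewrite lt0r_neq0.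
    by rewrite expr2 -[leRHS]mulrA ler_wpM2r // divr_ge0 ?mulr_ge0 // ltW.
  have -> : (Y / (2 * d%:R) * (Y / 2) = Y ^+ 2 / (16 * d%:R) * 4)%R.
    by field; rewrite lt0r_neq0.
  have : (0 < Y ^+ 2 / (16 * d%:R))%R by rewrite divr_gt0 ?exprn_gt0 ?mulr_gt0.
  have -> : (Y ^+ 2 / (8 * d%:R) = Y ^+ 2 / (16 * d%:R) * 2)%R.
    by field; rewrite lt0r_neq0.
  by move: PY; lra.
have [||| s [cs _ s_anti]] := greedy_selection (conf := fun i j : I => touching (val i) (val j))
    y0 (delta := Y / (2 * d%:R)) (Z := Y / 2) _ (k := d) (P := setT).
- by rewrite divr_ge0 ?mulr_ge0 // ltW.
- rewrite (eq_bigl predT); last by move=> i; rewrite inE.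
  apply: le_lt_trans few; apply: ler_sum => i _; rewrite le_eqVlt; apply/orP; left.
  by apply/eqP/eq_bigl => j; rewrite inE.
- rewrite [leRHS](eq_bigl predT); last by move=> i; rewrite inE.
  rewrite -/Y le_eqVlt; apply/orP; left; apply/eqP.
  by field; rewrite lt0r_neq0.
have i0 : I by case: s cs {s_anti} => [d0|//]; rewrite -d0 in d_gt0.
exists (fun k : 'I_d => val (nth i0 s k)); split=> [k|k l]; first exact: valP.
have anti_lt (x z : 'I_d) : x < z -> anticomplete (val (nth i0 s x)) (val (nth i0 s z)).
  move=> xz; apply: not_touching_anticomplete.
  by move/pairwiseP: s_anti => /(_ i0 x z); apply; rewrite ?inE ?cs.
rewrite neq_ltn => /orP[/anti_lt//|/anti_lt]; exact: anticomplete_sym.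
Qed.

(** The left side is at most 2 ^ (3 * m), whereas n_const + 1 is a power of c
    with exponent at least t_const, which is at least 4 * m. *)
Lemma bound_le_n_const (b c d m : nat) : 2 <= b -> 2 <= c -> 0 < d ->
  m = 16 * b * d * c ^ 2 -> 32 * (m * 2 ^ m + 1) * c * d <= n_const b c d.
Proof.
move=> hb hc hd mE.
have t_big : 4 * m <= t_const b c d.
  have -> : 4 * m = 2 ^ 6 * b * d * c ^ 2 by rewrite mE (_ : 2 ^ 6 = 4 * 16) ?mulnA.
  apply: (@leq_trans (2 ^ (6 + b + d + c ^ 2))).
    by rewrite !expnD; apply: leq_mul (leq_mul (leq_mul (leqnn _) _) _) _; exact/ltnW/ltn_expl.
  rewrite /t_const leq_exp2l // expnD.
  have Q_gt0 : 0 < 2 ^ (2 * c ^ 2) by rewrite expn_gt0.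
  have C4 : 2 * 2 <= c ^ 2 by rewrite leq_mul.
  move: (c ^ 2) (2 ^ _) Q_gt0 C4 => C Q Q_gt0 C4.
  apply: (@leq_trans (2 * (C * (2 * b + d - 1)))); first by nia.
  by rewrite -!mulnA leq_pmull.
have tau_gt0 : 0 < tau_const b c d by rewrite expn_gt0.
rewrite /n_const; set t := t_const b c d in t_big *; set tau := tau_const b c d in tau_gt0 *.
have m_gt : 32 * c * d <= m.
  have -> : m = 16 * (b * c) * c * d by rewrite mE -mulnn; lia.
  by rewrite !leq_mul2r; apply/orP; right; apply/orP; right; have := leq_mul hb hc; lia.
have m1 : m < 2 ^ m by rewrite ltn_expl.
rewrite subn1 -ltnS prednK ?expn_gt0 ?(ltnW hc) //.
apply: (@leq_ltn_trans (2 ^ (3 * m))).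
  have -> : 3 * m = m + m + m by lia.
  rewrite !expnD; set M := 2 ^ m in m1 *.
  have : m * M + 1 <= M * M by nia.
  set L := m * M + 1 => LM; have : 32 * c * d <= M by lia.
  move=> cdM; have -> : 32 * L * c * d = L * (32 * c * d) by rewrite -!mulnA; lia.
  exact: leq_mul.
apply: (@leq_trans (2 ^ (c * tau * (t - 1)))); last first.
  by case: (_ * (t - 1)) => [//|e]; rewrite leq_exp2r.
rewrite ltn_exp2l //.
have : 2 * 1 <= c * tau by rewrite leq_mul.
set X := c * tau => X2.
have : 2 * (t - 1) <= X * (t - 1) by rewrite leq_mul.
lia.
Qed.

Theorem theorem1p5 (b c d : nat) (hb : 2 <= b) (hc : 2 <= c) (hd : 0 < d)
  (G : sgraph) (hG : free (biclique b b) G)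
  (F : {set {set G}}) (hF : forall S : {set G}, S \in F -> 0 < #|S| < c) :
  (exists X : {set G},
     hitting_set F X /\ alpha (induced X) <= b * c * n_const b c d) \/
  (exists S : 'I_d -> {set G},
     (forall i, S i \in F) /\
     (forall i j, i != j -> anticomplete (S i) (S j))).
Proof.
have hF' (S : {set G}) : S \in F -> 0 < #|S| <= c.
  by move=> /hF/andP[-> /ltnW].
have [[X hX aX]|] := anticomplete_or_hitting (ltnW hb) (ltnW hc) hd hG hF' erefl erefl.
  left; exists X; split=> //; apply: leq_trans aX _.
  apply: (@leq_trans (c * n_const b c d)); first by rewrite leq_mul // bound_le_n_const.
  by rewrite leq_mul // leq_pmull // ltnW.
by right.
Qed.
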